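(* Let $(A_i;M_{ij};\varphi_{ikj})$ ($i,j,k=1,\dots,n$) be a generalised Morita context, let $t\in\{1,\dots,n\}$, put $R=A_t$, and let $(R,S;\,N,L;\,\zeta,\theta)$ be a Morita context. Let $(A_i';M_{ij}';\varphi_{ikj}')$ be their composition (at $t$), let $N_{\mathbf m}=(N_{ij})$ and $L_{\mathbf m}=(L_{ij})$ be the matrix bimodules given by column-excision and row-excision at $t$, and let $$|\underline{\alpha}_{ikj}|\colon N_{\mathbf m}\otimes_{[A_i';M_{ij}']}L_{\mathbf m}\to[A_i;M_{ij}],\qquad |\underline{\alpha}'_{ikj}|\colon L_{\mathbf m}\otimes_{[A_i;M_{ij}]}N_{\mathbf m}\to[A_i';M_{ij}']$$ be the maps induced by the column-row ligation and the row-column ligation at $t$. Then $$\big([A_i;M_{ij}],\,[A_i';M_{ij}'];\;N_{\mathbf m},\,L_{\mathbf m};\;|\underline{\alpha}_{ikj}|,\,|\underline{\alpha}'_{ikj}|\big)$$ is a Morita context.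
   Context: Rings are associative but not assumed unital, and modules are not assumed unital. For a ring $A$, $X\otimes_AY$ is the quotient of $X\otimes_{\mathbb Z}Y$ by the relations $xa\otimes y=x\otimes ay$. Morita context $(R,S;\,N,L;\,\zeta,\theta)$: rings $R,S$, bimodules ${}_RN_S$, ${}_SL_R$, an $R$-$R$-bimodule homomorphism $\zeta\colon N\otimes_SL\to R$ and an $S$-$S$-bimodule homomorphism $\theta\colon L\otimes_RN\to S$ with $\zeta(n\otimes l)n'=n\theta(l\otimes n')$ and $\theta(l\otimes n)l'=l\zeta(n\otimes l')$. Generalised Morita context $(A_i;M_{ij};\varphi_{ikj})$: rings $A_1,\dots,A_n$, $A_i$-$A_j$-bimodules $M_{ij}$ with $M_{ii}=A_i$, and $A_i$-$A_j$-bimodule homomorphisms $\varphi_{ikj}\colon M_{ik}\otimes_{A_k}M_{kj}\to M_{ij}$, where $\varphi_{kkj}$ and $\varphi_{ikk}$ are given by the left action of $A_k$ on $M_{kj}$ and the right action of $A_k$ on $M_{ik}$ (so $\varphi_{kkk}$ is multiplication), satisfying $\varphi_{ihj}(\mathbf 1\otimes\varphi_{hkj})=\varphi_{ikj}(\varphi_{ihk}\otimes\mathbf 1)$ for all $h,i,j,k$. Write $mm'=\varphi_{ikj}(m\otimes m')$. The generalised matrix ring $[A_i;M_{ij}]$ is the group of $n\times n$ matrices $(m_{ij})$, $m_{ij}\in M_{ij}$, with multiplication $(m_{ij})(m_{ij}')=(\sum_k m_{ik}m'_{kj})$. Composition at $t$ (with $R=A_t$): $A_t'=S$, $A_i'=A_i$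 for $i\ne t$; $M_{tt}'=S$, $M'_{it}=M_{it}\otimes_RN$ for $i\neq t$, $M'_{tj}=L\otimes_RM_{tj}$ for $j\ne t$, $M'_{ij}=M_{ij}$ for $i,j\neq t$. The maps $\varphi'_{ikj}\colon M_{ik}'\otimes_{A_k'}M_{kj}'\to M_{ij}'$ are: $s\otimes s'\mapsto ss'$ ($i=k=j=t$); $(m\otimes n)\otimes s\mapsto m\otimes ns$ ($k=j=t\ne i$); $s\otimes(l\otimes m)\mapsto sl\otimes m$ ($i=k=t\neq j$); $(l\otimes m)\otimes(m'\otimes n)\mapsto\theta(l(mm')\otimes n)$ ($i=j=t\ne k$); $m\otimes(m'\otimes n)\mapsto mm'\otimes n$ ($j=t\ne i,k$); $(l\otimes m)\otimes m'\mapsto l\otimes mm'$ ($i=t\ne k,j$); $(m\otimes n)\otimes(l\otimes m')\mapsto (m\zeta(n\otimes l))m'$ ($k=t\ne i,j$); $m\otimes m'\mapsto mm'$ ($i,j,k\neq t$). This is a generalised Morita context, with generalised matrix ring $[A_i';M_{ij}']$. Column-excision $N_{\mathbf m}=(N_{ij})$: the group of $n\times n$ matrices with $N_{it}=M_{it}\otimes_RN$ for all $i$ (so $N_{tt}=R\otimes_RN$) and $N_{ij}=M_{ij}$ for $j\ne t$. It is an $[A_i;M_{ij}]$-$[A_i';M_{ij}']$-bimodule via $(m_{ij})(x_{ij})=(\sum_k\beta_{ikj}(m_{ik}\otimes x_{kj}))$ and $(x_{ij})(m'_{ij})=(\sum_k\beta'_{ikj}(x_{ik}\otimes m'_{kj}))$,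 where $\beta_{ikj}=\varphi_{ikj}$ for $j\ne t$ and $\beta_{ikt}=\varphi_{ikt}\otimes\mathbf 1_N$; $\beta'_{ikj}=\varphi'_{ikj}$ for $i\ne t$; and $\beta'_{tkj}$ is: $(r\otimes n)\otimes s\mapsto r\otimes ns$ ($k=j=t$); $(r\otimes n)\otimes(l\otimes m)\mapsto r\zeta(n\otimes l)m$ ($k=t\neq j$); $m\otimes(m'\otimes n)\mapsto mm'\otimes n$ ($k\ne t=j$); $m\otimes m'\mapsto mm'$ ($k,j\neq t$). Row-excision $L_{\mathbf m}=(L_{ij})$: the group of $n\times n$ matrices with $L_{tj}=L\otimes_RM_{tj}$ for all $j$ (so $L_{tt}=L\otimes_RR$) and $L_{ij}=M_{ij}$ for $i\neq t$. It is an $[A_i';M_{ij}']$-$[A_i;M_{ij}]$-bimodule via $(m'_{ij})(y_{ij})=(\sum_k\gamma'_{ikj}(m'_{ik}\otimes y_{kj}))$ and $(y_{ij})(m_{ij})=(\sum_k\gamma_{ikj}(y_{ik}\otimes m_{kj}))$, where $\gamma_{ikj}=\varphi_{ikj}$ for $i\neq t$ and $\gamma_{tkj}=\mathbf 1_L\otimes\varphi_{tkj}$; $\gamma'_{ikj}=\varphi'_{ikj}$ for $j\ne t$; and $\gamma'_{ikt}$ is: $s\otimes(l\otimes r)\mapsto sl\otimes r$ ($i=k=t$); $(l\otimes m)\otimes m'\mapsto l\otimes mm'$ ($i=t\neq k$); $(m\otimes n)\otimes(l\otimes r)\mapsto m\zeta(n\otimes l)r$ ($i\ne t=k$); $m\otimes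 m'\mapsto mm'$ ($i,k\neq t$). Column-row ligation: $|\alpha_{ikj}|\colon N_{\mathbf m}\times L_{\mathbf m}\to[A_i;M_{ij}]$, $((x_{ij}),(y_{ij}))\mapsto(\sum_k\alpha_{ikj}(x_{ik}\otimes y_{kj}))$, where $\alpha_{ikj}\colon N_{ik}\otimes_{A_k'}L_{kj}\to M_{ij}$ is $\varphi_{ikj}$ for $k\ne t$, and $\alpha_{itj}\colon(m\otimes n)\otimes(l\otimes m')\mapsto(m\zeta(n\otimes l))m'$. It is $[A_i';M_{ij}']$-balanced; the induced map on the tensor product is $|\underline\alpha_{ikj}|$. Row-column ligation: $|\alpha'_{ikj}|\colon L_{\mathbf m}\times N_{\mathbf m}\to[A'_i;M'_{ij}]$, $((y_{ij}),(x_{ij}))\mapsto(\sum_k\alpha'_{ikj}(y_{ik}\otimes x_{kj}))$, where $\alpha'_{ikj}\colon L_{ik}\otimes_{A_k}N_{kj}\to M'_{ij}$ is: $m\otimes m'\mapsto mm'$ ($i,j\neq t$); $m\otimes(m'\otimes n)\mapsto mm'\otimes n$ ($i\neq t=j$); $(l\otimes m)\otimes m'\mapsto l\otimes mm'$ ($i=t\ne j$); $(l\otimes m)\otimes(m'\otimes n)\mapsto\theta(l(mm')\otimes n)$ ($i=j=t$). It is $[A_i;M_{ij}]$-balanced; the induced map on the tensor product is $|\underline\alpha'_{ikj}|$. *)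

(* Defs.v *)
From HB Require Import structures.
From mathcomp Require Import all_boot all_order all_algebra.
From mathcomp Require Import ring_quotient freeg.
From mathcomp Require Import boolp.

Set Implicit Arguments.
Unset Strict Implicit.
Unset Printing Implicit Defensive.

Import GRing.Theory.
Local Open Scope ring_scope.
Local Open Scope quotient_scope.

(* MathComp's ring and module structures are unital, so rings and bimodules   *)
(* without unit are given here by their operations ([rngData], [bimodData]),  *)
(* and the axioms are the separate predicates [is_rng], [is_bimod].           *)

Definition biadditive (X Y Z : zmodType) (f : X -> Y -> Z) : Prop :=
  (forall x, {morph f x : y y' / y + y'}) /\
  (forall y, {morph f^~ y : x x' / x + x'}).

Record rngData := RngData {
  rcar :> zmodType;
  rmul : rcar -> rcar -> rcar
}.

Definition is_rng (R : rngData) : Prop :=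
  biadditive (@rmul R) /\ associative (@rmul R).

Record bimodData (R S : rngData) := BimodData {
  bcar :> zmodType;
  lact : R -> bcar -> bcar;
  ract : bcar -> S -> bcar
}.
Arguments lact {R S b}.
Arguments ract {R S b}.

Record is_bimod (R S : rngData) (X : bimodData R S) : Prop := IsBimod {
  lact_biadd : biadditive (@lact R S X);
  ract_biadd : biadditive (@ract R S X);
  lactA : forall (a b : R) (x : X), lact (rmul a b) x = lact a (lact b x);
  ractA : forall (x : X) (a b : S), ract x (rmul a b) = ract (ract x a) b;
  lractA : forall (a : R) (x : X) (b : S), ract (lact a x) b = lact a (ract x b)
}.

Definition regular (R : rngData) : bimodData R R :=
  @BimodData R R R (@rmul R) (@rmul R).

Record is_bimod_hom (R S : rngData) (X Y : bimodData R S) (f : X -> Y) : Prop :=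
  IsBimodHom {
    hom_add : {morph f : x x' / x + x'};
    hom_lact : forall (a : R) (x : X), f (lact a x) = lact a (f x);
    hom_ract : forall (x : X) (b : S), f (ract x b) = ract (f x) b
  }.

(* The tensor product of X and Y over S: the free abelian group on X * Y      *)
(* modulo the subgroup spanned by the biadditivity and balancing relations.   *)
Section Tensor.
Variables (R S T : rngData) (X : bimodData R S) (Y : bimodData S T).

Local Notation free := {freeg (X * Y)%type / int}.

Inductive tens_span : free -> Prop :=
| tens_span0 : tens_span 0
| tens_spanB D D' : tens_span D -> tens_span D' -> tens_span (D - D')
| tens_spanDl x x' y :
    tens_span (<< (x + x', y) >> - << (x, y) >> - << (x', y) >>)
| tens_spanDr x y y' :
    tens_span (<< (x, y + y') >> - << (x, y) >> - << (x, y') >>)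
| tens_span_bal x s y :
    tens_span (<< (ract x s, y) >> - << (x, lact s y) >>).

Definition tens_ker : {pred free} := fun D => `[< tens_span D >].

Lemma tens_ker_zmod_closed : zmod_closed tens_ker.
Proof.
split=> [|D D' /asboolP HD /asboolP HD']; apply/asboolP.
  exact: tens_span0.
exact: tens_spanB.
Qed.

HB.instance Definition _ :=
  GRing.isZmodClosed.Build free tens_ker tens_ker_zmod_closed.

Definition tens_group : zmodType := Quotient.quot tens_ker.

Definition tpure (x : X) (y : Y) : tens_group := \pi_tens_group << (x, y) >>.

(* The map induced on the tensor product by a biadditive balanced f; the      *)
(* choice of representative is immaterial for such f ([tlift_pure],           *)
(* [tliftD]), and the value is meaningless for any other f.  [zmodule Z] is Z   *)
(* seen as a module over int.                                                 *)
Definition tlift (Z : zmodType) (f : X -> Y -> Z) (u : tens_group) : Z :=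
  fglift (fun p : X * Y => f p.1 p.2 : zmodule Z) (repr u).

Definition balanced (Z : zmodType) (f : X -> Y -> Z) : Prop :=
  forall x s y, f (ract x s) y = f x (lact s y).

End Tensor.

Arguments tpure {R S T X Y} x y.
Arguments tlift {R S T X Y Z} f u.

Section TensorLift.
Variables (R S T : rngData) (X : bimodData R S) (Y : bimodData S T).
Variables (Z : zmodType) (f : X -> Y -> Z).
Hypotheses (fD : biadditive f) (fB : balanced f).

Local Notation free := {freeg (X * Y)%type / int}.
Let F : free -> zmodule Z := fglift (fun p : X * Y => f p.1 p.2 : zmodule Z).

Let FB : {morph F : D D' / D - D'}.
Proof. exact: lift_is_additive. Qed.

Let FU x y : F << (x, y) >> = f x y.
Proof. by rewrite /F liftU scale1r. Qed.

Let F_span D : tens_span D -> F D = 0.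
Proof.
elim=> [|E E' _ EE _ EE'|x x' y|x y y'|x s y].
- by rewrite -(subrr (0 : free)) FB subrr.
- by rewrite FB EE EE' subrr.
- by rewrite !FB !FU fD.2 addrAC addrK subrr.
- by rewrite !FB !FU fD.1 addrAC addrK subrr.
- by rewrite FB !FU fB subrr.
Qed.

Let tlift_pi D : tlift f (\pi_(tens_group X Y) D) = F D.
Proof.
apply/eqP; rewrite /tlift -/F -subr_eq0 -FB; apply/eqP/F_span.
have : repr (\pi_(tens_group X Y) D) = D %[mod tens_group X Y] by rewrite reprK.
by move/eqP; rewrite -Quotient.idealrBE => /asboolP.
Qed.

Lemma tlift_pure x y : tlift f (tpure x y) = f x y.
Proof. by rewrite tlift_pi FU. Qed.

Lemma tliftD : {morph tlift f : u v / u + v}.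
Proof.
move=> u v; rewrite -[u]reprK -[v]reprK -[X in tlift f X]raddfD !tlift_pi.
have FN E : F (- E) = - F E.
  by rewrite -[- E]add0r FB (F_span (tens_span0 X Y)) sub0r.
by rewrite -{1}[repr v]opprK FB FN opprK.
Qed.

End TensorLift.

Definition tens (R S T : rngData) (X : bimodData R S) (Y : bimodData S T) :
    bimodData R T :=
  @BimodData R T (tens_group X Y)
    (fun a => tlift (fun x y => tpure (lact a x) y))
    (fun u b => tlift (fun x y => tpure x (ract y b)) u).

Record is_morita_context (R S : rngData) (N : bimodData R S) (L : bimodData S R)
    (zeta : tens N L -> R) (theta : tens L N -> S) : Prop := IsMoritaContext {
  morita_rngl : is_rng R;
  morita_rngr : is_rng S;
  morita_bimodl : is_bimod N;
  morita_bimodr : is_bimod L;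
  morita_zeta : @is_bimod_hom R R (tens N L) (regular R) zeta;
  morita_theta : @is_bimod_hom S S (tens L N) (regular S) theta;
  morita_zetaA : forall (n : N) (l : L) (n' : N),
    lact (zeta (tpure n l)) n' = ract n (theta (tpure l n'));
  morita_thetaA : forall (l : L) (n : N) (l' : L),
    lact (theta (tpure l n)) l' = ract l (zeta (tpure n l'))
}.

(* The groups M_ij together with the multiplication of A_i = M_ii and the     *)
(* actions of A_i and A_j on M_ij.                                            *)
Record bimodSystem (n : nat) := BimodSystem {
  sobj : 'I_n -> 'I_n -> zmodType;
  smul : forall i, sobj i i -> sobj i i -> sobj i i;
  slact : forall i j, sobj i i -> sobj i j -> sobj i j;
  sract : forall i j, sobj i j -> sobj j j -> sobj i j
}.

Definition srng n (B : bimodSystem n) (i : 'I_n) : rngData :=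
  RngData (@smul n B i).

Definition sbim n (B : bimodSystem n) (i j : 'I_n) :
    bimodData (srng B i) (srng B j) :=
  @BimodData (srng B i) (srng B j) (sobj B i j) (@slact n B i j) (@sract n B i j).

Record gmcData (n : nat) := GmcData {
  gsys :> bimodSystem n;
  gphi : forall i k j, tens (sbim gsys i k) (sbim gsys k j) -> sbim gsys i j
}.
Arguments gphi {n} g i k j u.

(* The product m m' = phi_ikj (m (x) m') *)
Definition gmul n (G : gmcData n) (i k j : 'I_n)
    (m : sbim G i k) (m' : sbim G k j) : sbim G i j :=
  gphi G i k j (tpure m m').

Record is_gmc (n : nat) (G : gmcData n) : Prop := IsGmc {
  gmc_rng : forall i, is_rng (srng G i);
  gmc_bimod : forall i j, is_bimod (sbim G i j);
  gmc_diagl : forall i (a b : srng G i), @slact n G i i a b = rmul a b;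
  gmc_diagr : forall i (a b : srng G i), @sract n G i i a b = rmul a b;
  gmc_phi : forall i k j, is_bimod_hom (gphi G i k j);
  gmc_phil : forall k j (a : srng G k) (m : sbim G k j),
    @gmul n G k k j a m = lact a m;
  gmc_phir : forall i k (m : sbim G i k) (a : srng G k),
    @gmul n G i k k m a = ract m a;
  gmc_phiA : forall i h k j
      (m : sbim G i h) (m' : sbim G h k) (m'' : sbim G k j),
    gmul m (gmul m' m'') = gmul (gmul m m') m''
}.

(* Square matrices whose (i, j) entry lies in M i j.                          *)
Section DepMatrix.
Variables (n : nat) (M : 'I_n -> 'I_n -> zmodType).

Definition dmatrix : Type := {dffun forall ij : 'I_n * 'I_n, M ij.1 ij.2}.

Definition dmx (f : forall i j, M i j) : dmatrix := finfun (fun ij => f ij.1 ij.2).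
Definition dentry (A : dmatrix) i j : M i j := A (i, j).

Lemma dmxE f i j : dentry (dmx f) i j = f i j.
Proof. by rewrite /dentry /dmx ffunE. Qed.

Lemma dmxP (A B : dmatrix) : (forall i j, dentry A i j = dentry B i j) -> A = B.
Proof. by move=> AB; apply/ffunP=> -[i j]; apply: AB. Qed.

Definition dmx_add A B := dmx (fun i j => dentry A i j + dentry B i j).
Definition dmx_opp A := dmx (fun i j => - dentry A i j).
Definition dmx_zero := dmx (fun i j => 0).

Lemma dmx_addA : associative dmx_add.
Proof. by move=> A B C; apply: dmxP => i j; rewrite !dmxE addrA. Qed.
Lemma dmx_addC : commutative dmx_add.
Proof. by move=> A B; apply: dmxP => i j; rewrite !dmxE addrC. Qed.
Lemma dmx_add0 : left_id dmx_zero dmx_add.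
Proof. by move=> A; apply: dmxP => i j; rewrite !dmxE add0r. Qed.
Lemma dmx_addN : left_inverse dmx_zero dmx_opp dmx_add.
Proof. by move=> A; apply: dmxP => i j; rewrite !dmxE addNr. Qed.

HB.instance Definition _ := Choice.on dmatrix.
HB.instance Definition _ :=
  GRing.isZmodule.Build dmatrix dmx_addA dmx_addC dmx_add0 dmx_addN.

End DepMatrix.

(* The generalised matrix ring [A_i; M_ij] *)
Definition gmx n (G : gmcData n) : rngData :=
  @RngData (dmatrix (sobj G)) (fun A B =>
    dmx (fun i j => \sum_k gmul (dentry A i k : sbim G i k)
                                (dentry B k j : sbim G k j))).

Section Composition.
Variables (n : nat) (G : gmcData n) (t : 'I_n).
Local Notation R := (srng G t).
Variables (S : rngData) (N : bimodData R S) (L : bimodData S R).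
Variables (zeta : tens N L -> R) (theta : tens L N -> S).

(* M_ij with its row index (if bi) or its column index (if bj) composed with  *)
(* the Morita context: a composed index stands for t, whatever the value of i *)
(* or j.  Thus M'_ij, N_ij, L_ij and M_ij are cobj bi bj i j with             *)
(* (bi, bj) = (i == t, j == t), (false, j == t), (i == t, false) and          *)
(* (false, false).  In N_tj and L_it the index t is not composed in the row,  *)
(* resp. the column, so N_tt = R (x) N and L_tt = L (x) R.                    *)
Definition cobj (bi bj : bool) (i j : 'I_n) : zmodType :=
  match bi, bj with
  | true,  true  => S
  | false, true  => tens (sbim G i t) N
  | true,  false => tens L (sbim G t j)
  | false, false => sbim G i j
  end.

Definition cmul b i : cobj b b i i -> cobj b b i i -> cobj b b i i :=
  match b with
  | true  => fun s s' : S => rmul s s'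
  | false => fun a a' : srng G i => rmul a a'
  end.

Definition clact bi bj i j : cobj bi bi i i -> cobj bi bj i j -> cobj bi bj i j :=
  match bi, bj with
  | true,  true  => fun s s' : S => rmul s s'
  | false, true  => fun (a : srng G i) (u : tens (sbim G i t) N) => lact a u
  | true,  false => fun (s : S) (v : tens L (sbim G t j)) => lact s v
  | false, false => fun (a : srng G i) (m : sbim G i j) => lact a m
  end.

Definition cract bi bj i j : cobj bi bj i j -> cobj bj bj j j -> cobj bi bj i j :=
  match bi, bj with
  | true,  true  => fun s s' : S => rmul s s'
  | false, true  => fun (u : tens (sbim G i t) N) (s : S) => ract u s
  | true,  false => fun (v : tens L (sbim G t j)) (a : srng G j) => ract v a
  | false, false => fun (m : sbim G i j) (a : srng G j) => ract m a
  end.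

(* All the maps phi', beta, beta', gamma, gamma', alpha, alpha' below are     *)
(* given by the same eight formulas, according to which of the three indices  *)
(* are composed; each is represented by its values (x, y) |-> f (x (x) y).    *)
Definition cprod bi bk bj i k j :
    cobj bi bk i k -> cobj bk bj k j -> cobj bi bj i j :=
  match bi, bk, bj with
  | true, true, true => fun s s' : S => rmul s s'
  | false, true, true => fun (u : tens (sbim G i t) N) (s : S) =>
      tlift (fun (m : sbim G i t) (x : N) => tpure m (ract x s)) u
  | true, true, false => fun (s : S) (v : tens L (sbim G t j)) =>
      tlift (fun (l : L) (m : sbim G t j) => tpure (lact s l) m) v
  | true, false, true =>
      fun (v : tens L (sbim G t k)) (u : tens (sbim G k t) N) =>
      tlift (fun (l : L) (m : sbim G t k) =>
        tlift (fun (m' : sbim G k t) (x : N) =>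
          theta (tpure (ract l (gmul m m' : R)) x)) u) v
  | false, false, true => fun (m : sbim G i k) (u : tens (sbim G k t) N) =>
      tlift (fun (m' : sbim G k t) (x : N) => tpure (gmul m m') x) u
  | true, false, false => fun (v : tens L (sbim G t k)) (m' : sbim G k j) =>
      tlift (fun (l : L) (m : sbim G t k) => tpure l (gmul m m')) v
  | false, true, false =>
      fun (u : tens (sbim G i t) N) (v : tens L (sbim G t j)) =>
      tlift (fun (m : sbim G i t) (x : N) =>
        tlift (fun (l : L) (m' : sbim G t j) =>
          gmul (ract m (zeta (tpure x l))) m') v) u
  | false, false, false => fun (m : sbim G i k) (m' : sbim G k j) => gmul m m'
  end.

Definition comp_sys : bimodSystem n :=
  @BimodSystem n
    (fun i j => cobj (i == t) (j == t) i j)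
    (fun i => @cmul (i == t) i)
    (fun i j => @clact (i == t) (j == t) i j)
    (fun i j => @cract (i == t) (j == t) i j).

Definition composition : gmcData n :=
  @GmcData n comp_sys
    (fun i k j => @tlift _ _ _ (sbim comp_sys i k) (sbim comp_sys k j)
       (sbim comp_sys i j) (@cprod (i == t) (k == t) (j == t) i k j)).

Definition col_obj (i j : 'I_n) : zmodType := cobj false (j == t) i j.

Definition beta i k j : sobj G i k -> col_obj k j -> col_obj i j :=
  @cprod false false (j == t) i k j.

Definition beta' i k j : col_obj i k -> sobj composition k j -> col_obj i j :=
  @cprod false (k == t) (j == t) i k j.

Definition col_excision : bimodData (gmx G) (gmx composition) :=
  @BimodData (gmx G) (gmx composition) (dmatrix col_obj)
    (fun A X => dmx (fun i j => \sum_k beta (dentry A i k) (dentry X k j)))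
    (fun X B => dmx (fun i j => \sum_k beta' (dentry X i k) (dentry B k j))).

Definition row_obj (i j : 'I_n) : zmodType := cobj (i == t) false i j.

Definition gamma' i k j : sobj composition i k -> row_obj k j -> row_obj i j :=
  @cprod (i == t) (k == t) false i k j.

Definition gamma i k j : row_obj i k -> sobj G k j -> row_obj i j :=
  @cprod (i == t) false false i k j.

Definition row_excision : bimodData (gmx composition) (gmx G) :=
  @BimodData (gmx composition) (gmx G) (dmatrix row_obj)
    (fun B Y => dmx (fun i j => \sum_k gamma' (dentry B i k) (dentry Y k j)))
    (fun Y A => dmx (fun i j => \sum_k gamma (dentry Y i k) (dentry A k j))).

Definition alpha i k j : col_obj i k -> row_obj k j -> sobj G i j :=
  @cprod false (k == t) false i k j.

Definition alpha' i k j : row_obj i k -> col_obj k j -> sobj composition i j :=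
  @cprod (i == t) false (j == t) i k j.

Definition col_row_ligation (X : col_excision) (Y : row_excision) : gmx G :=
  dmx (fun i j => \sum_k alpha (dentry X i k) (dentry Y k j)).

Definition row_col_ligation (Y : row_excision) (X : col_excision) :
    gmx composition :=
  dmx (fun i j => \sum_k alpha' (dentry Y i k) (dentry X k j)).

End Composition.

Arguments composition {n G t S N L} zeta theta.
Arguments col_excision {n G t S N L} zeta theta.
Arguments row_excision {n G t S N L} zeta theta.
Arguments col_row_ligation {n G t S N L} zeta theta X Y.
Arguments row_col_ligation {n G t S N L} zeta theta Y X.

(* Main.v *)
Require Import Defs.
From mathcomp Require Import all_boot all_algebra.
From mathcomp Require Import ring_quotient freeg.
From mathcomp Require Import boolp.

Set Implicit Arguments.
Unset Strict Implicit.
Unset Printing Implicit Defensive.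

Import GRing.Theory.
Local Open Scope ring_scope.
Local Open Scope quotient_scope.

(** Adjoin to the objects 1, ..., n of the generalised Morita context one more
    object 0, linked to [t] by the given Morita context: the groups are [M_ij],
    [M_it (x) N] at (i, 0), [L (x) M_tj] at (0, j) and [S] at (0, 0).  The eight
    formulas [cprod] are the compositions of this extended system.  It is again
    a generalised Morita context, that is, [cprod] is biadditive
    ([cprod_biadditive]) and associative ([cprodA]); for associativity it
    suffices to compare two triple products of pure tensors, which comes down to
    the associativity of [G], the two Morita identities and the bilinearity of
    [zeta] and [theta].

    The composed system is the extended one with 0 put in the place of [t].
    So the matrix ring of [G], the matrix ring of the composition and the two
    excisions are the matrices over the extended system whose rows are indexed
    either by (1, ..., t, ..., n) or by (1, ..., 0, ..., n), and whose columns
    are indexed likewise.  All the products and actions in the statement, and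
    both ligations, are the single matrix product [ext_mul] of such matrices.
    Biadditivity and associativity pass from entries to matrices
    ([ext_mul_biadditive], [ext_mulA]), and every axiom of a Morita context for
    the excisions follows from these two facts. *)

(** * Additive and biadditive maps *)

Lemma biadditive_flip (X Y Z : zmodType) (f : X -> Y -> Z) :
  biadditive f -> biadditive (fun y x => f x y).
Proof. by case. Qed.

Lemma biadditive_comp (X Y Z W : zmodType) (h : Z -> W) (f : X -> Y -> Z) :
  {morph h : a b / a + b} -> biadditive f -> biadditive (fun x y => h (f x y)).
Proof. by move=> hD fD; split=> a b c /=; rewrite ?fD.1 ?fD.2 hD. Qed.

Lemma additiveB (X Z : zmodType) (f : X -> Z) :
  {morph f : a b / a + b} -> {morph f : a b / a - b}.
Proof. by move=> fD a b; apply: (addIr (f b)); rewrite -fD !subrK. Qed.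

(** * Tensor products of non-unital bimodules *)

Section TensorFacts.
Variables (R S T : rngData) (X : bimodData R S) (Y : bimodData S T).

Lemma tpure_biadditive : biadditive (@tpure R S T X Y).
Proof.
split=> [x y y'|y x x']; rewrite /tpure -raddfD; apply/eqP;
  rewrite -Quotient.idealrBE; apply/asboolP; rewrite opprD addrA.
- exact: tens_spanDr.
- exact: tens_spanDl.
Qed.

Lemma tpure_balanced : balanced (@tpure R S T X Y).
Proof.
move=> x s y; rewrite /tpure; apply/eqP.
by rewrite -Quotient.idealrBE; apply/asboolP/tens_span_bal.
Qed.

(** Closure under differences alone suffices, because it gives closure under
    integer multiples and a tensor is an integer combination of pure ones. *)
Lemma tens_ind (P : tens X Y -> Prop) :
  (forall u v, P u -> P v -> P (u - v)) -> (forall x y, P (tpure x y)) ->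
  forall u, P u.
Proof.
move=> PB Ppure u.
have P0 : P 0 by rewrite -(subrr (tpure 0 0)); apply: (PB).
have PD v w : P v -> P w -> P (v + w).
  by move=> Pv Pw; rewrite -[w]opprK -[- w]sub0r; do 2![apply: (PB) => //].
have PM v m : P v -> P (v *~ m).
  move=> Pv; have PMn k : P (v *+ k).
    elim: k => // k IHk; rewrite mulrS.
    exact: PD.
  case: m => k; first exact: PMn.
  by rewrite NegzE mulrNz -sub0r; apply: (PB) => //; apply: PMn.
rewrite -[u]reprK; elim/freeg_ind_dom0: (repr u) => [|m p D _ _ PD'].
  by rewrite raddf0.
rewrite raddfD; apply: PD => //.
rewrite -[m]intz -freegU_mulz raddfMz; apply: PM.
by case: p => x y; apply: Ppure.
Qed.

Lemma tens_ext (Z : zmodType) (f g : tens X Y -> Z) :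
  {morph f : u v / u + v} -> {morph g : u v / u + v} ->
  (forall x y, f (tpure x y) = g (tpure x y)) -> f =1 g.
Proof.
move=> fD gD fg; elim/tens_ind => // u v fgu fgv.
by rewrite !additiveB // fgu fgv.
Qed.

(** Additivity in the parameter cannot be read off from the definition of
    [tlift], which evaluates at a chosen representative; it holds because both
    sides are additive in the tensor and agree on pure tensors. *)
Lemma tlift_biadditive (A Z : zmodType) (f : A -> X -> Y -> Z) :
  (forall a, biadditive (f a)) -> (forall a, balanced (f a)) ->
  (forall x y, {morph (fun a => f a x y) : a b / a + b}) ->
  biadditive (fun a u => tlift (f a) u).
Proof.
move=> fD fB fA; split=> [a|u a b]; first exact: tliftD.
pose F (c : A) v := tlift (f c) v.
have FD c : {morph F c : v w / v + w} by apply: tliftD.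
apply: (@tens_ext _ (F (a + b)) (fun v => F a v + F b v)) => // [v w|x y].
  by rewrite !FD addrACA.
by rewrite /F !tlift_pure //; apply: fA.
Qed.

End TensorFacts.

(** Two tensors can be eliminated in succession: this is what gives a meaning to
    the formulas for [cprod] that take two tensors apart at once. *)
Section TensorPair.
Variables (R S T R' S' T' : rngData).
Variables (X : bimodData R S) (Y : bimodData S T).
Variables (X' : bimodData R' S') (Y' : bimodData S' T').
Variables (Z : zmodType) (f : X -> Y -> X' -> Y' -> Z).
Hypotheses (fDl : forall x' y', biadditive (fun x y => f x y x' y')).
Hypotheses (fBl : forall x' y', balanced (fun x y => f x y x' y')).
Hypotheses (fDr : forall x y, biadditive (f x y)).
Hypotheses (fBr : forall x y, balanced (f x y)).

Let inner_biadditive v : biadditive (fun x y => tlift (f x y) v).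
Proof.
split=> [x|y].
- by have [] := @tlift_biadditive _ _ _ _ _ _ _ (f x) (fDr x) (fBr x)
    (fun x' y' => (fDl x' y').1 x).
- by have [] := @tlift_biadditive _ _ _ _ _ _ _ (f^~ y) (fDr^~ y) (fBr^~ y)
    (fun x' y' => (fDl x' y').2 y).
Qed.

Let inner_balanced v : balanced (fun x y => tlift (f x y) v).
Proof.
move=> x s y; apply: (tens_ext _ _ _ v) => [||x' y']; try exact: tliftD.
by rewrite !tlift_pure // fBl.
Qed.

Lemma tlift2_biadditive :
  biadditive (fun u v => tlift (fun x y => tlift (f x y) v) u).
Proof.
apply/biadditive_flip/(@tlift_biadditive _ _ _ _ _ _ _
  (fun v x y => tlift (f x y) v)) => //.
by move=> x y u v; rewrite tliftD.
Qed.

Lemma tlift2_pure x y x' y' :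
  tlift (fun x y => tlift (f x y) (tpure x' y')) (tpure x y) = f x y x' y'.
Proof. by rewrite tlift_pure ?tlift_pure. Qed.

End TensorPair.

(** The maps [p a (x) 1] and [1 (x) p _ a], for a family of bimodule maps depending
    additively on [a].  They cover the actions on a tensor product as well as the
    formulas for [cprod] that involve only one tensor. *)
Section TensorMaps.
Variables (R S T : rngData) (X : bimodData R S) (Y : bimodData S T).

Section Left.
Variables (A : zmodType) (R' : rngData) (X' : bimodData R' S).
Variables (p : A -> X -> X') (pD : biadditive p).
Hypothesis p_ract : forall a x s, p a (ract x s) = ract (p a x) s.

Let fD a : biadditive (fun (x : X) (y : Y) => tpure (p a x) y).
Proof.
by split=> [x|y] ? ? /=; rewrite ?pD.1 ?(tpure_biadditive _ _).1
  ?(tpure_biadditive _ _).2.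
Qed.

Let fB a : balanced (fun (x : X) (y : Y) => tpure (p a x) y).
Proof. by move=> x s y; rewrite p_ract tpure_balanced. Qed.

Lemma tensl_biadditive :
  biadditive (fun a => tlift (fun (x : X) (y : Y) => tpure (p a x) y)).
Proof.
apply: (@tlift_biadditive _ _ _ _ _ _ _
  (fun a (x : X) (y : Y) => tpure (p a x) y)) => // x y a b.
by rewrite pD.2 (tpure_biadditive _ _).2.
Qed.

Lemma tensl_pure a x y :
  tlift (fun (x : X) (y : Y) => tpure (p a x) y) (tpure x y) = tpure (p a x) y.
Proof. by rewrite tlift_pure. Qed.
End Left.

Section Right.
Variables (A : zmodType) (T' : rngData) (Y' : bimodData S T').
Variables (p : Y -> A -> Y') (pD : biadditive p).
Hypothesis p_lact : forall a s y, p (lact s y) a = lact s (p y a).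

Let fD a : biadditive (fun (x : X) (y : Y) => tpure x (p y a)).
Proof.
by split=> [x|y] ? ? /=; rewrite ?pD.2 ?(tpure_biadditive _ _).1
  ?(tpure_biadditive _ _).2.
Qed.

Let fB a : balanced (fun (x : X) (y : Y) => tpure x (p y a)).
Proof. by move=> x s y; rewrite p_lact tpure_balanced. Qed.

Lemma tensr_biadditive :
  biadditive (fun u a => tlift (fun (x : X) (y : Y) => tpure x (p y a)) u).
Proof.
apply/biadditive_flip/(@tlift_biadditive _ _ _ _ _ _ _ 
   (fun a (x : X) (y : Y) => tpure x (p y a))) => // x y a b.
by rewrite pD.1 (tpure_biadditive _ _).1.
Qed.

Lemma tensr_pure a x y :
  tlift (fun (x : X) (y : Y) => tpure x (p y a)) (tpure x y) = tpure x (p y a).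
Proof. by rewrite tlift_pure. Qed.
End Right.

Section Actions.
Hypotheses (hX : is_bimod X) (hY : is_bimod Y).

Lemma tens_lact a (x : X) (y : Y) :
  lact a (tpure x y : tens X Y) = tpure (lact a x) y.
Proof.
by apply: tensl_pure (a) (x) (y); [case: hX | move=> *; rewrite (lractA hX)].
Qed.

Lemma tens_ract (x : X) (y : Y) b :
  ract (tpure x y : tens X Y) b = tpure x (ract y b).
Proof.
by apply: tensr_pure (b) (x) (y); [case: hY | move=> *; rewrite (lractA hY)].
Qed.

Lemma tens_lactD a : {morph @lact R T (tens X Y) a : u v / u + v}.
Proof.
by apply: (tensl_biadditive _ _).1; [case: hX | move=> *; rewrite (lractA hX)].
Qed.

Lemma tens_ractD b : {morph (@ract R T (tens X Y))^~ b : u v / u + v}.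
Proof.
by apply: (tensr_biadditive _ _).2; [case: hY | move=> *; rewrite (lractA hY)].
Qed.
End Actions.
End TensorMaps.

(** The bimodule part of a Morita context may be checked on pure tensors. *)
Lemma tlift_bimod_hom (R S : rngData) (X : bimodData R S) (Y : bimodData S R)
    (f : X -> Y -> R) :
  is_bimod X -> is_bimod Y -> is_rng R -> biadditive f -> balanced f ->
  (forall a x y, f (lact a x) y = rmul a (f x y)) ->
  (forall x y b, f x (ract y b) = rmul (f x y) b) ->
  @is_bimod_hom R R (tens X Y) (regular R) (tlift f).
Proof.
move=> hX hY [RD _] fD fB fl fr; have fluD := tliftD fD fB.
split=> // [a u|u b].
- apply: (tens_ext (f := fun u => tlift f (lact a u))
                   (g := fun u => rmul a (tlift f u))) u => [v w|v w|x y].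
  + by rewrite -fluD; congr (tlift f _); apply: tens_lactD.
  + by rewrite fluD; apply: RD.1.
  + by rewrite tens_lact // !tlift_pure.
- apply: (tens_ext (f := fun u => tlift f (ract u b))
                   (g := fun u => rmul (tlift f u) b)) u => [v w|v w|x y].
  + by rewrite -fluD; congr (tlift f _); apply: tens_ractD.
  + by rewrite fluD; apply: RD.2.
  + by rewrite tens_ract // !tlift_pure.
Qed.

(** * Rules for the products of a (generalised) Morita context *)

(** The actions on the [M_ij] are themselves products with the diagonal entries,
    so that their compatibilities are cases of the associativity of [gmul]. *)
Section GmcFacts.
Variables (n : nat) (G : gmcData n) (hG : is_gmc G).

Lemma gmul_biadditive i k j : biadditive (@gmul n G i k j).
Proof.
exact: biadditive_comp (hom_add (gmc_phi hG i k j)) (tpure_biadditive _ _).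
Qed.

Lemma gmul_ract i k j (m : sbim G i k) (m' : sbim G k j) (a : srng G j) :
  gmul m (ract m' a) = ract (gmul m m') a.
Proof. by rewrite -!(gmc_phir hG) (gmc_phiA hG). Qed.

Lemma gmul_lact i k j (a : srng G i) (m : sbim G i k) (m' : sbim G k j) :
  gmul (lact a m) m' = lact a (gmul m m').
Proof. by rewrite -!(gmc_phil hG) (gmc_phiA hG). Qed.

Lemma gmul_balanced i k j (m : sbim G i k) (a : srng G k) (m' : sbim G k j) :
  gmul (ract m a) m' = gmul m (lact a m').
Proof. by rewrite -(gmc_phil hG) -(gmc_phir hG) (gmc_phiA hG). Qed.

Lemma sbim_lact i (a : srng G i) (b : sbim G i i) :
  lact a b = @rmul (srng G i) a b.
Proof. exact: gmc_diagl. Qed.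

Lemma sbim_ract i (a : sbim G i i) (b : srng G i) :
  ract a b = @rmul (srng G i) a b.
Proof. exact: gmc_diagr. Qed.
End GmcFacts.

Section MoritaFacts.
Variables (R S : rngData) (N : bimodData R S) (L : bimodData S R).
Variables (zeta : tens N L -> R) (theta : tens L N -> S).
Hypothesis hM : is_morita_context zeta theta.

Lemma zeta_biadditive : biadditive (fun x l => zeta (tpure x l)).
Proof.
exact: biadditive_comp (hom_add (morita_zeta hM)) (tpure_biadditive _ _).
Qed.

Lemma theta_biadditive : biadditive (fun l x => theta (tpure l x)).
Proof.
exact: biadditive_comp (hom_add (morita_theta hM)) (tpure_biadditive _ _).
Qed.

Lemma zeta_lact a x l : zeta (tpure (lact a x) l) = rmul a (zeta (tpure x l)).
Proof. by rewrite -(tens_lact (morita_bimodl hM)) (hom_lact (morita_zeta hM)). Qed.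

Lemma zeta_ract x l a : zeta (tpure x (ract l a)) = rmul (zeta (tpure x l)) a.
Proof. by rewrite -(tens_ract (morita_bimodr hM)) (hom_ract (morita_zeta hM)). Qed.

Lemma theta_lact s l x : theta (tpure (lact s l) x) = rmul s (theta (tpure l x)).
Proof. by rewrite -(tens_lact (morita_bimodr hM)) (hom_lact (morita_theta hM)). Qed.

Lemma theta_ract l x s : theta (tpure l (ract x s)) = rmul (theta (tpure l x)) s.
Proof. by rewrite -(tens_ract (morita_bimodl hM)) (hom_ract (morita_theta hM)). Qed.
End MoritaFacts.

(** * The eight products are biadditive and associative *)

Section CompositionProduct.
Variables (n : nat) (G : gmcData n) (t : 'I_n) (S : rngData).
Variables (N : bimodData (srng G t) S) (L : bimodData S (srng G t)).
Variables (zeta : tens N L -> srng G t) (theta : tens L N -> S).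
Hypotheses (hG : is_gmc G) (hM : is_morita_context zeta theta).

Local Notation cobj := (@cobj n G t S N L).
Local Notation cprod := (@cprod n G t S N L zeta theta).

Let hN : is_bimod N := morita_bimodl hM.
Let hL : is_bimod L := morita_bimodr hM.

Definition is_pure bi bj i j : cobj bi bj i j -> Prop :=
  match bi, bj with
  | false, true => fun u => exists m x, u = tpure (m : sbim G i t) (x : N)
  | true, false => fun v => exists l m, v = tpure (l : L) (m : sbim G t j)
  | _, _ => fun _ => True
  end.

(** One extensionality principle for the four kinds of groups, so that the
    sixteen cases of [cprodA] share the reduction to pure tensors. *)
Lemma cobj_ext bi bj i j (Z : zmodType) (f g : cobj bi bj i j -> Z) :
  {morph f : u v / u + v} -> {morph g : u v / u + v} ->
  (forall u, is_pure u -> f u = g u) -> f =1 g.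
Proof.
case: bi bj f g => -[] f g fD gD fg; try by move=> u; apply: fg.
- by apply: tens_ext => // l m; apply: fg; exists l, m.
- by apply: tens_ext => // m x; apply: fg; exists m, x.
Qed.

(** In the names below, the letters tell for each of the indices i, k, j in turn
    whether it is the adjoined object (T) or one of 1, ..., n (F). *)
Lemma cprod_FTT_biadditive i k j : biadditive (@cprod false true true i k j).
Proof.
by apply: tensr_biadditive; [case: hN | move=> *; rewrite (lractA hN)].
Qed.

Lemma cprod_FTT i k j (m : sbim G i t) x s :
  @cprod false true true i k j (tpure m x) s = tpure m (ract x s).
Proof.
by apply: tensr_pure (s) (m) (x); [case: hN | move=> *; rewrite (lractA hN)].
Qed.

Lemma cprod_TTF_biadditive i k j : biadditive (@cprod true true false i k j).
Proof.
by apply: tensl_biadditive; [case: hL | move=> *; rewrite (lractA hL)].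
Qed.

Lemma cprod_TTF i k j s l (m : sbim G t j) :
  @cprod true true false i k j s (tpure l m) = tpure (lact s l) m.
Proof.
by apply: tensl_pure (s) (l) (m); [case: hL | move=> *; rewrite (lractA hL)].
Qed.

Lemma cprod_FFT_biadditive i k j : biadditive (@cprod false false true i k j).
Proof.
apply: tensl_biadditive; first exact: gmul_biadditive.
by move=> *; apply: gmul_ract.
Qed.

Lemma cprod_FFT i k j m (m' : sbim G k t) x :
  @cprod false false true i k j m (tpure m' x) = tpure (gmul m m') x.
Proof.
apply: tensl_pure (m) (m') (x); first exact: gmul_biadditive.
by move=> *; apply: gmul_ract.
Qed.

Lemma cprod_TFF_biadditive i k j : biadditive (@cprod true false false i k j).
Proof.
apply: tensr_biadditive; first exact: gmul_biadditive.
by move=> *; apply: gmul_lact.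
Qed.

Lemma cprod_TFF i k j l (m : sbim G t k) m' :
  @cprod true false false i k j (tpure l m) m' = tpure l (gmul m m').
Proof.
apply: tensr_pure (m') (l) (m); first exact: gmul_biadditive.
by move=> *; apply: gmul_lact.
Qed.

Section TFT.
Variables (k : 'I_n).
Let f (l : L) (m : sbim G t k) (m' : sbim G k t) (x : N) : S :=
  theta (tpure (ract l (gmul m m' : srng G t)) x).

Let fDl m' x : biadditive (fun l m => f l m m' x).
Proof.
split=> [l|m] u v; rewrite /f.
  by rewrite (gmul_biadditive hG _ _ _).2 (ract_biadd hL).1 (theta_biadditive hM).2.
by rewrite (ract_biadd hL).2 (theta_biadditive hM).2.
Qed.

Let fBl m' x : balanced (fun l m => f l m m' x).
Proof. by move=> l a m; rewrite /f gmul_lact // sbim_lact // (ractA hL). Qed.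

Let fDr l m : biadditive (f l m).
Proof.
split=> [m'|x] u v; rewrite /f; first by rewrite (theta_biadditive hM).1.
by rewrite (gmul_biadditive hG _ _ _).1 (ract_biadd hL).1 (theta_biadditive hM).2.
Qed.

Let fBr l m : balanced (f l m).
Proof.
by move=> m' a x; rewrite /f gmul_ract // sbim_ract // -tpure_balanced (ractA hL).
Qed.

Lemma cprod_TFT_biadditive i j : biadditive (@cprod true false true i k j).
Proof. exact: (tlift2_biadditive fDl fBl fDr fBr). Qed.

Lemma cprod_TFT i j l (m : sbim G t k) (m' : sbim G k t) x :
  @cprod true false true i k j (tpure l m) (tpure m' x) =
    theta (tpure (ract l (gmul m m' : srng G t)) x).
Proof. exact: (tlift2_pure fDl fBl fDr fBr). Qed.
End TFT.

Section FTF.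
Variables (i j : 'I_n).
Let f (m : sbim G i t) (x : N) (l : L) (m' : sbim G t j) : sbim G i j :=
  gmul (ract m (zeta (tpure x l))) m'.

Let fDl l m' : biadditive (fun m x => f m x l m').
Proof.
split=> [m|x] u v; rewrite /f.
  by rewrite (zeta_biadditive hM).2 (ract_biadd (gmc_bimod hG _ _)).1
    (gmul_biadditive hG _ _ _).2.
by rewrite (ract_biadd (gmc_bimod hG _ _)).2 (gmul_biadditive hG _ _ _).2.
Qed.

Let fBl l m' : balanced (fun m x => f m x l m').
Proof.
by move=> m a x; rewrite /f (zeta_lact hM) (ractA (gmc_bimod hG _ _)).
Qed.

Let fDr m x : biadditive (f m x).
Proof.
split=> [l|m'] u v; rewrite /f; first by rewrite (gmul_biadditive hG _ _ _).1.
by rewrite (zeta_biadditive hM).1 (ract_biadd (gmc_bimod hG _ _)).1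
  (gmul_biadditive hG _ _ _).2.
Qed.

Let fBr m x : balanced (f m x).
Proof.
by move=> l a m'; rewrite /f (zeta_ract hM) (ractA (gmc_bimod hG _ _)) gmul_balanced.
Qed.

Lemma cprod_FTF_biadditive k : biadditive (@cprod false true false i k j).
Proof. exact: (tlift2_biadditive fDl fBl fDr fBr). Qed.

Lemma cprod_FTF k (m : sbim G i t) x l (m' : sbim G t j) :
  @cprod false true false i k j (tpure m x) (tpure l m') =
    gmul (ract m (zeta (tpure x l))) m'.
Proof. exact: (tlift2_pure fDl fBl fDr fBr). Qed.
End FTF.

Lemma cprod_biadditive bi bk bj i k j : biadditive (@cprod bi bk bj i k j).
Proof.
case: bi bk bj => -[] [].
- by case: (morita_rngr hM).
- exact: cprod_TTF_biadditive.
- exact: cprod_TFT_biadditive.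
- exact: cprod_TFF_biadditive.
- exact: cprod_FTT_biadditive.
- exact: cprod_FTF_biadditive.
- exact: cprod_FFT_biadditive.
- exact: gmul_biadditive.
Qed.

Lemma cprodDr bi bk bj i k j x : {morph @cprod bi bk bj i k j x : y y' / y + y'}.
Proof. by case: (cprod_biadditive bi bk bj i k j). Qed.

Lemma cprodDl bi bk bj i k j y :
  {morph (fun x => @cprod bi bk bj i k j x y) : x x' / x + x'}.
Proof. by case: (cprod_biadditive bi bk bj i k j). Qed.

Lemma cprod_TTT i k j (s s' : S) :
  @cprod true true true i k j s s' = rmul s s'.
Proof. by []. Qed.

Lemma cprod_FFF i k j (m : sbim G i k) (m' : sbim G k j) :
  @cprod false false false i k j m m' = gmul m m'.
Proof. by []. Qed.

Let cprodE := (cprod_TTT, cprod_FFF, cprod_FTT, cprod_TTF, cprod_FFT,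
  cprod_TFF, cprod_TFT, cprod_FTF).

(** Associativity in the extended system, checked on pure tensors: most cases are
    the associativity of [gmul], of [S] or of an action, or the bilinearity of
    [theta]; the Morita identities enter when the adjoined object and the
    others alternate. *)
Lemma cprodA bi bh bk bj i h k j (x : cobj bi bh i h) (y : cobj bh bk h k)
    (z : cobj bk bj k j) :
  @cprod bi bh bj i h j x (@cprod bh bk bj h k j y z) =
  @cprod bi bk bj i k j (@cprod bi bh bk i h k x y) z.
Proof.
have hS := morita_rngr hM.
apply: (cobj_ext (f := fun x => cprod x (cprod y z))
                 (g := fun x => cprod (cprod x y) z)) x => [u v|u v|x gx].
- by rewrite cprodDl.
- by rewrite !cprodDl.
apply: (cobj_ext (f := fun y => cprod x (cprod y z))
                 (g := fun y => cprod (cprod x y) z)) y => [u v|u v|y gy].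
- by rewrite cprodDl cprodDr.
- by rewrite cprodDr cprodDl.
apply: (cobj_ext (f := fun z => cprod x (cprod y z))
                 (g := fun z => cprod (cprod x y) z)) z => [u v|u v|z gz].
- by rewrite !cprodDr.
- by rewrite !cprodDr.
case: bi bh bk bj x y z gx gy gz => -[] [] [] x y z; rewrite /is_pure.
- move=> _ _ _; rewrite !cprodE; exact: hS.2.
- move=> _ _ [l [m ->]]; rewrite !cprodE (lactA hL) //.
- move=> _ [l [m ->]] [m' [u ->]]; rewrite !cprodE (lractA hL) (theta_lact hM) //.
- move=> _ [l [m ->]] _; rewrite !cprodE //.
- move=> [l [m ->]] [m' [u ->]] _; rewrite !cprodE (theta_ract hM) //.
- move=> [l [m ->]] [m' [u ->]] [l' [m'' ->]]; rewrite !cprodE.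
  (* theta(l(mm') (x) u) l' = l(mm') zeta(u (x) l'), whose scalar then moves
     across the tensor sign. *)
  rewrite (morita_thetaA hM) -(ractA hL) tpure_balanced -(gmc_phil hG).
  by rewrite -(sbim_ract hG) -gmul_ract // (gmc_phiA hG).
- move=> [l [m ->]] _ [m' [u ->]]; rewrite !cprodE (gmc_phiA hG) //.
- move=> [l [m ->]] _ _; rewrite !cprodE (gmc_phiA hG) //.
- move=> [m [u ->]] _ _; rewrite !cprodE (ractA hN) //.
- move=> [m [u ->]] _ [l [m' ->]]; rewrite !cprodE tpure_balanced //.
- move=> [m [u ->]] [l [m' ->]] [m'' [u' ->]]; rewrite !cprodE.
  (* u theta(l(m'm'') (x) u') = zeta(u (x) l)(m'm'') u', whose scalar then moves
     across the tensor sign. *)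
  rewrite -(morita_zetaA hM) (zeta_ract hM) -tpure_balanced.
  by rewrite (ractA (gmc_bimod hG _ _)) -(gmc_phir hG) (gmc_phiA hG).
- move=> [m [u ->]] [l [m' ->]] _; rewrite !cprodE (gmc_phiA hG) //.
- move=> _ [m [u ->]] _; rewrite !cprodE //.
- move=> _ [m [u ->]] [l [m' ->]]; rewrite !cprodE (gmc_phiA hG) gmul_ract //.
- move=> _ _ [m [u ->]]; rewrite !cprodE (gmc_phiA hG) //.
- move=> _ _ _; rewrite !cprodE (gmc_phiA hG) //.
Qed.

(** The actions that the composed system carries on its entries are products with
    its diagonal entries.  With [cprodA] this gives the balancedness which makes
    the induced maps [phi'] evaluate to [cprod] on pure tensors. *)
Lemma clact_cprod b bj i j (a : cobj b b i i) (x : cobj b bj i j) :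
  clact a x = cprod a x.
Proof.
case: b bj a x => -[] a x //=; last by rewrite (gmc_phil hG).
congr (tlift _ x); apply/funext => m; apply/funext => u.
by rewrite (gmc_phil hG).
Qed.

Lemma cract_cprod bi b i j (x : cobj bi b i j) (a : cobj b b j j) :
  cract x a = cprod x a.
Proof.
case: bi b x a => -[] x a //=; last by rewrite (gmc_phir hG).
congr (tlift _ x); apply/funext => l; apply/funext => m.
by rewrite (gmc_phir hG).
Qed.
End CompositionProduct.

(** * Matrices over the extended system *)

Lemma additive_sum (X Z : zmodType) (f : X -> Z) (I : finType) (F : I -> X) :
  {morph f : a b / a + b} -> f (\sum_i F i) = \sum_i f (F i).
Proof.
move=> fD; apply: (big_morph f fD).
by apply: (addrI (f 0)); rewrite -fD !addr0.
Qed.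

Section BlockMatrices.
Variables (n : nat) (G : gmcData n) (t : 'I_n) (S : rngData).
Variables (N : bimodData (srng G t) S) (L : bimodData S (srng G t)).
Variables (zeta : tens N L -> srng G t) (theta : tens L N -> S).
Hypotheses (hG : is_gmc G) (hM : is_morita_context zeta theta).

(** [b] (resp. [b']) tells whether the adjoined object replaces [t] among the row
    (resp. column) indices.  As [false && _] and [true && _] compute, the four
    instances are convertible to the underlying groups of [gmx G], the excisions
    and the matrix ring of the composition. *)
Definition ext_matrix (b b' : bool) : zmodType :=
  dmatrix (fun i j => @cobj n G t S N L (b && (i == t)) (b' && (j == t)) i j).

Definition ext_mul b c d (A : ext_matrix b c) (B : ext_matrix c d) :
    ext_matrix b d :=
  dmx (fun i j => \sum_k cprod zeta theta (dentry A i k) (dentry B k j)).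

Lemma dentryD M (A B : dmatrix M) (i j : 'I_n) :
  dentry (A + B) i j = dentry A i j + dentry B i j.
Proof. exact: dmxE. Qed.

Lemma ext_mul_biadditive b c d : biadditive (@ext_mul b c d).
Proof.
split=> [A B B'|B A A'] /=; apply: dmxP => i j;
  rewrite dentryD !dmxE -big_split; apply: eq_bigr => k _; rewrite dentryD.
- exact: cprodDr.
- exact: cprodDl.
Qed.

Lemma ext_mulA b c d e (A : ext_matrix b c) (B : ext_matrix c d)
    (C : ext_matrix d e) :
  ext_mul A (ext_mul B C) = ext_mul (ext_mul A B) C.
Proof.
apply: dmxP => i j; rewrite !dmxE.
transitivity (\sum_k \sum_h cprod zeta theta
    (cprod zeta theta (dentry A i k) (dentry B k h)) (dentry C h j)).
  apply: eq_bigr => k _; rewrite dmxE additive_sum; last exact: cprodDr.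
  by apply: eq_bigr => h _; apply: cprodA.
rewrite exchange_big; apply: eq_bigr => h _; rewrite dmxE.
rewrite (additive_sum (f := fun x => cprod zeta theta x (dentry C h j))) //.
exact: cprodDl.
Qed.

Let R' := composition zeta theta.

Lemma composition_gmul i k j (x : sbim R' i k) (y : sbim R' k j) :
  gmul x y = cprod zeta theta x y :> sobj R' i j.
Proof.
rewrite /gmul /= tlift_pure //; first exact: cprod_biadditive.
move=> {}x s {}y.
have -> : ract x s = cprod zeta theta x (s : sobj R' k k) by apply: cract_cprod.
have -> : lact s y = cprod zeta theta (s : sobj R' k k) y by apply: clact_cprod.
by rewrite cprodA.
Qed.

(** The one product of the statement that is not convertible to [ext_mul], as the
    composition is given by its maps on tensor products. *)
Lemma gmx_compositionE (A B : ext_matrix true true) :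
  @rmul (gmx R') A B = ext_mul A B.
Proof.
apply: dmxP => i j; rewrite !dmxE; apply: eq_bigr => k _.
by rewrite composition_gmul.
Qed.

Lemma gmx_is_rng : is_rng (gmx G).
Proof.
split; first exact: (ext_mul_biadditive false false false).
exact: (@ext_mulA false false false false). Qed.

Lemma gmx_composition_is_rng : is_rng (gmx R').
Proof.
split; first split.
- by move=> A B B'; rewrite !gmx_compositionE (ext_mul_biadditive _ _ _).1.
- by move=> B A A'; rewrite !gmx_compositionE (ext_mul_biadditive _ _ _).2.
- by move=> A B C; rewrite !gmx_compositionE ext_mulA.
Qed.

Lemma col_excision_is_bimod : is_bimod (col_excision zeta theta).
Proof.
split.
- exact: (ext_mul_biadditive false false true).
- exact: (ext_mul_biadditive false true true).
- by move=> A B X; apply/esym/(@ext_mulA false false false true).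
- by move=> X A B; rewrite gmx_compositionE; apply: (@ext_mulA false true true true).
- by move=> A X B; apply/esym/(@ext_mulA false false true true).
Qed.

Lemma row_excision_is_bimod : is_bimod (row_excision zeta theta).
Proof.
split.
- exact: (ext_mul_biadditive true true false).
- exact: (ext_mul_biadditive true false false).
- by move=> A B X; rewrite gmx_compositionE; apply/esym/(@ext_mulA true true true false).
- by move=> X A B; apply: (@ext_mulA true false false false).
- by move=> A X B; apply/esym/(@ext_mulA true true false false).
Qed.

Lemma col_row_biadditive : biadditive (col_row_ligation zeta theta).
Proof. exact: (ext_mul_biadditive false true false). Qed.

Lemma col_row_balanced : balanced (col_row_ligation zeta theta).
Proof. by move=> X A Y; apply/esym/(@ext_mulA false true true false). Qed.

Lemma row_col_biadditive : biadditive (row_col_ligation zeta theta).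
Proof. exact: (ext_mul_biadditive true false true). Qed.

Lemma row_col_balanced : balanced (row_col_ligation zeta theta).
Proof. by move=> X A Y; apply/esym/(@ext_mulA true false false true). Qed.
End BlockMatrices.

Theorem theorem3p14 (n : nat) (G : gmcData n) (t : 'I_n) (S : rngData)
    (N : bimodData (srng G t) S) (L : bimodData S (srng G t))
    (zeta : tens N L -> srng G t) (theta : tens L N -> S) :
  is_gmc G ->
  is_morita_context zeta theta ->
  is_morita_context
    (tlift (col_row_ligation zeta theta) :
       tens (col_excision zeta theta) (row_excision zeta theta) -> gmx G)
    (tlift (row_col_ligation zeta theta) :
       tens (row_excision zeta theta) (col_excision zeta theta) ->
       gmx (composition zeta theta)).
Proof.
move=> hG hM.
have mA := @ext_mulA _ _ _ _ _ _ zeta theta hG hM.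
have hC := col_excision_is_bimod hG hM; have hR := row_excision_is_bimod hG hM.
have aD := col_row_biadditive hG hM; have aB := col_row_balanced hG hM.
have a'D := row_col_biadditive hG hM; have a'B := row_col_balanced hG hM.
split=> //.
- exact: (gmx_is_rng hG hM).
- exact: gmx_composition_is_rng.
- apply: tlift_bimod_hom => //; first exact: (gmx_is_rng hG hM).
  + by move=> A X Y; apply/esym/(mA false false true false).
  + by move=> X Y A; apply: (mA false true false false).
- apply: tlift_bimod_hom => //; first exact: gmx_composition_is_rng.
  + move=> A Y X; rewrite gmx_compositionE //.
    by apply/esym/(mA true true false true).
  + move=> Y X A; rewrite gmx_compositionE //.
    by apply: (mA true false true true).
- move=> X Y X'; rewrite !tlift_pure //.
  by apply/esym/(mA false true false true).
- move=> Y X Y'; rewrite !tlift_pure //.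
  by apply/esym/(mA true false true false).
Qed.
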